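(* Let $X$ be a uniformly smooth Banach space (real or complex) with modulus of smoothness $\rho(u)\le\gamma u^q$, $1<q\le2$, and let $\mathcal{D}$ be a dictionary in $X$. Let $K_1>0$ and define the schedule $\varepsilon=\{\varepsilon_n\}_{n=1}^\infty$ by $$\varepsilon_n:=K_1\gamma^{1/q}n^{-1/p},\qquad p=\frac{q}{q-1},\quad n=1,2,\dots.$$ Then, for any $f\in\operatorname{conv}(\mathcal{D})$, the residuals $f_m^{cc,\varepsilon}$ of the Incremental Algorithm (complex and convex) with schedule $\varepsilon$ (IAcc($\varepsilon$)) applied to $f$ with respect to $\mathcal{D}$ satisfy $$\|f_m^{cc,\varepsilon}\|\le C(K_1)\gamma^{1/q}m^{-1/p},\qquad m=1,2,\dots,$$ where $C(K_1)$ is a constant depending on $K_1$.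
   Context: A dictionary in a Banach space $X$ is a set $\mathcal{D}\subset X$ such that $\|g\|\le 1$ for each $g\in\mathcal{D}$ and the closure of $\operatorname{span}\mathcal{D}$ is $X$. $\operatorname{conv}(\mathcal{D})$ denotes the closure in $X$ of the convex hull of $\mathcal{D}$. For a nonzero element $h\in X$, $F_h$ denotes a norming (peak) functional for $h$: $F_h\in X^*$, $\|F_h\|=1$, $F_h(h)=\|h\|$. The modulus of smoothness of $X$ is $\rho(u):=\sup_{\|x\|=\|y\|=1}\left(\frac12(\|x+uy\|+\|x-uy\|)-1\right)$; $X$ is uniformly smooth if $\lim_{u\to0}\rho(u)/u=0$. IAcc($\varepsilon$), for a schedule $\varepsilon=\{\varepsilon_n\}_{n=1}^\infty$, $\varepsilon_n>0$, and $f\in\operatorname{conv}(\mathcal{D})$: set $f_0^{cc,\varepsilon}:=f$ and $G_0^{cc,\varepsilon}:=0$. Then, for each $m\ge1$, define inductively: (1) $\varphi_m^{cc,\varepsilon}\in\mathcal{D}$ is any element satisfying $\operatorname{Re}\big(F_{f_{m-1}^{cc,\varepsilon}}(\varphi_m^{cc,\varepsilon}-f)\big)\ge-\varepsilon_m$. (2) $G_m^{cc,\varepsilon}:=(1-1/m)G_{m-1}^{cc,\varepsilon}+\varphi_m^{cc,\varepsilon}/m$. (3) $f_m^{cc,\varepsilon}:=f-G_m^{cc,\varepsilon}$. (In the real case $\operatorname{Re}$ is the identity.) *)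

(* Defs.v *)
From HB Require Import structures.
From mathcomp Require Import all_boot all_order all_algebra.
From mathcomp Require Import complex.
From mathcomp Require Import all_classical all_reals all_analysis.

Set Implicit Arguments.
Unset Strict Implicit.
Unset Printing Implicit Defensive.

Import Order.TTheory GRing.Theory Num.Theory.
Import numFieldNormedType.Exports.

Local Open Scope classical_set_scope.
Local Open Scope ring_scope.
Local Open Scope complex_scope.

Variant field_kind := RealField | ComplexField.

Definition scalar_field (R : realType) (k : field_kind) : numFieldType :=
  match k with RealField => R | ComplexField => R[i] end.

Definition scalar_re (R : realType) (k : field_kind) : scalar_field R k -> R :=
  match k with
  | RealField => fun x => x
  | ComplexField => fun z => complex.Re z
  end.

Definition scalar_of_real (R : realType) (k : field_kind) : R -> scalar_field R k :=
  match k with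
  | RealField => fun x => x
  | ComplexField => fun x => x%:C
  end.

Arguments scalar_re {R k}.
Arguments scalar_of_real {R k}.

Section IncrementalAlgorithm.
Context (R : realType) (k : field_kind).
Let K : numFieldType := scalar_field R k.

(* The norm of a [normedModType K] takes its values in K, hence in R[i] for
   complex spaces; its value is a nonnegative real, recovered by [scalar_re]. *)
Definition rnorm (V : normedModType K) (x : V) : R := scalar_re `|x|.

Context (X : completeNormedModType K).

Definition smoothness_modulus (u : R) : R :=
  sup [set r : R | exists x y : X,
    [/\ rnorm x = 1, rnorm y = 1 &
        r = (rnorm (x + scalar_of_real u *: y)
             + rnorm (x - scalar_of_real u *: y)) / 2 - 1]].

Definition uniformly_smooth : Prop :=
  smoothness_modulus u / u @[u --> (0 : R)^'] --> (0 : R).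

Definition linear_span (D : set X) : set X :=
  [set x | exists (n : nat) (a : 'I_n -> K) (g : 'I_n -> X),
    (forall i, D (g i)) /\ x = \sum_(i < n) a i *: g i].

Definition dictionary (D : set X) : Prop :=
  (forall g, D g -> rnorm g <= 1) /\ closure (linear_span D) = setT.

(* [convex_set] only involves scalars t of K with 0 <= t <= 1, which are real
   also when K = R[i]. *)
Definition closed_conv (D : set X) : set X :=
  closure (smallest (@convex_set K X) D).

(* [sup] is 0 on unbounded sets, so the value is meaningful for bounded
   functionals only. *)
Definition dual_norm (F : X -> K^o) : R :=
  sup [set rnorm (F x) | x in [set x : X | rnorm x <= 1]].

Definition norming_functional (h : X) (F : {linear X -> K^o}) : Prop :=
  [/\ continuous F, dual_norm F = 1 & F h = `|h|].

(* [phi], [G], [r] are the sequences phi_m (m >= 1; [phi 0] is irrelevant),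
   G_m and f_m of one run of the algorithm. Norming functionals are defined for
   nonzero elements only, so once the residual vanishes any element of the
   dictionary may be chosen. *)
Record IAcc_run (D : set X) (eps : nat -> R) (f : X) (phi G r : nat -> X)
    : Prop := {
  IAcc_G0 : G 0%N = 0;
  IAcc_r0 : r 0%N = f;
  IAcc_phi : forall m : nat, (0 < m)%N -> D (phi m);
  IAcc_greedy : forall m : nat, (0 < m)%N -> r m.-1 != 0 ->
    exists F : {linear X -> K^o}, norming_functional (r m.-1) F /\
      - eps m <= scalar_re (F (phi m - f));
  IAcc_G : forall m : nat, (0 < m)%N ->
    G m = (1 - m%:R^-1) *: G m.-1 + m%:R^-1 *: phi m;
  IAcc_r : forall m : nat, (0 < m)%N -> r m = f - G m }.

End IncrementalAlgorithm.

Arguments smoothness_modulus {R k} X u.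
Arguments uniformly_smooth {R k} X.

(* Main.v *)
Require Import Defs.
From HB Require Import structures.
From mathcomp Require Import all_boot all_order all_algebra.
From mathcomp Require Import all_classical all_reals all_analysis.
From mathcomp Require Import complex.
From mathcomp Require Import ring lra.
Import Order.TTheory GRing.Theory Num.Theory.
Import numFieldNormedType.Exports.
Local Open Scope classical_set_scope.
Local Open Scope ring_scope.

(** The residuals satisfy
      [f_n = (1 - 1/n) f_(n-1) - (1/n) (phi_n - f)],
    so each step perturbs the shrunken residual [x = (1 - 1/n) f_(n-1)], of norm
    [A], by the small vector [y = (1/n) (phi_n - f)], of norm at most [2/n].
    In a smooth space the perturbation is linear up to the modulus of
    smoothness: [|x + y| + |x - y| <= 2 |x| (1 + rho (|y| / |x|))], and
    [|x + y| >= Re F(x + y) = |x| + Re F(y)] for a functional [F] norming [x],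
    whence [|x - y| <= |x| - Re F(y) + 2 |x| rho (|y| / |x|)]
    ([rnorm_sub_le_smoothness]). A functional norming [f_(n-1)] also norms [x],
    and the greedy condition bounds [- Re F(y)] by [eps_n / n]. With
    [rho u <= gamma u^q] this gives
      [|f_n| <= A + eps_n / n + 2 A gamma (2 / (n A))^q].

    Put [b = gamma^(1/q)] and [s = 1/p = 1 - 1/q]. The rate [n^(-s)] follows by
    induction on [n] ([incremental_recursion]), according to the size of [A].
    If [A <= b n^(-s)], the triangle inequality
    [|f_n| <= A + 2/n] is enough, because [1 <= 2 b]: the modulus of any nonzero
    space is at least [1] at [u = 2] ([power_type_constant_ge]). If
    [A > b n^(-s)], both error terms are at most a constant times
    [b n^(-1-s)], whereas the factor [1 - 1/n] makes the bound
    [C b (n-1)^(-s)] shrink below [C b n^(-s)] by at least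
    [(C / q) b n^(-1-s)] ([powR_succ_contract]). As [1/q >= 1/2], the constant
    [C = 2 K1 + 16] makes this gain absorb the errors, for every space, every
    [q] and every [gamma]. *)

(** * Real and complex scalars *)

Section Scalars.
Context {R : realType} {k : field_kind}.
Implicit Types (a b : R) (z w : scalar_field R k).

Lemma scalar_reD z w : scalar_re (z + w) = scalar_re z + scalar_re w.
Proof. by case: k z w => // -[? ?] [? ?]. Qed.

Lemma scalar_reM a z : scalar_re (scalar_of_real a * z) = a * scalar_re z.
Proof. by case: k z => // -[x y] /=; rewrite mul0r subr0. Qed.

Lemma scalar_re_le z w : z <= w -> scalar_re z <= scalar_re w.
Proof. by case: k z w => // z w; rewrite lecE => /andP[]. Qed.

Lemma scalar_re_ge0_inj z : 0 <= z -> scalar_of_real (scalar_re z) = z.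
Proof. by case: k z => // -[x y]; rewrite lecE /= => /andP[/eqP-> _]. Qed.

Lemma scalar_re_le_norm z : scalar_re z <= scalar_re `|z|.
Proof.
case: k z => [z|z]; first exact: ler_norm.
by have := normc_ge_Re z; rewrite lecE /= => /andP[_]; apply: le_trans (ler_norm _).
Qed.

Lemma scalar_of_real_norm a :
  `|scalar_of_real a : scalar_field R k| = scalar_of_real `|a|.
Proof. by case: k => //=; rewrite normc_def /= expr0n addr0 sqrtr_sqr. Qed.

Lemma scalar_of_realM a b :
  scalar_of_real (a * b) = scalar_of_real a * scalar_of_real b
    :> scalar_field R k.
Proof. by case: k => //=; rewrite rmorphM. Qed.

Lemma scalar_of_real1 : scalar_of_real 1 = 1 :> scalar_field R k.
Proof. by case: k. Qed.

Lemma scalar_of_realD a b :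
  scalar_of_real (a + b) = scalar_of_real a + scalar_of_real b
    :> scalar_field R k.
Proof. by case: k => //=; rewrite rmorphD. Qed.

Lemma scalar_of_realB a b :
  scalar_of_real (a - b) = scalar_of_real a - scalar_of_real b
    :> scalar_field R k.
Proof. by case: k => //=; rewrite rmorphB. Qed.

Lemma scalar_of_real_natV (n : nat) :
  scalar_of_real n%:R^-1 = n%:R^-1 :> scalar_field R k.
Proof. by case: k => //=; rewrite fmorphV /= rmorph_nat. Qed.

Lemma scalar_of_real_lt a b :
  ((scalar_of_real a : scalar_field R k) < scalar_of_real b) = (a < b).
Proof. by case: k => //=; rewrite ltcR. Qed.

End Scalars.

(** * The real-valued norm *)

Section RealNorm.
Context {R : realType} {k : field_kind}.
Local Notation K := (scalar_field R k).
Context {V : normedModType K}.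
Implicit Types (x y : V) (a : R).

Lemma rnormE x : scalar_of_real (rnorm x) = `|x|.
Proof. exact: scalar_re_ge0_inj. Qed.

Lemma rnorm0 : rnorm (0 : V) = 0.
Proof. by rewrite /rnorm normr0; case: (k). Qed.

Lemma rnorm_ge0 x : 0 <= rnorm x.
Proof. by rewrite -rnorm0; apply: scalar_re_le; rewrite normr0. Qed.

Lemma rnorm_eq0 x : (rnorm x == 0) = (x == 0).
Proof.
apply/eqP/eqP => [x0|->]; last exact: rnorm0.
by apply/normr0_eq0; rewrite -rnormE x0; case: (k).
Qed.

Lemma rnorm_gt0 x : (0 < rnorm x) = (x != 0).
Proof. by rewrite lt_neqAle rnorm_ge0 andbT eq_sym rnorm_eq0. Qed.

Lemma rnormD x y : rnorm (x + y) <= rnorm x + rnorm y.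
Proof. by rewrite /rnorm -scalar_reD; apply/scalar_re_le/ler_normD. Qed.

Lemma rnormN x : rnorm (- x) = rnorm x.
Proof. by rewrite /rnorm normrN. Qed.

Lemma rnormB x y : rnorm (x - y) <= rnorm x + rnorm y.
Proof. by rewrite -(rnormN y) rnormD. Qed.

Lemma rnormZ a x : rnorm (scalar_of_real a *: x) = `|a| * rnorm x.
Proof. by rewrite /rnorm normrZ scalar_of_real_norm scalar_reM. Qed.

Lemma rnormZ_ge0 a x : 0 <= a -> rnorm (scalar_of_real a *: x) = a * rnorm x.
Proof. by move=> a0; rewrite rnormZ ger0_norm. Qed.

Lemma scalar_of_realZA a b x :
  scalar_of_real a *: (scalar_of_real b *: x) = scalar_of_real (a * b) *: x.
Proof. by rewrite scalerA scalar_of_realM. Qed.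

Lemma scale_normalize x : x != 0 ->
  scalar_of_real (rnorm x) *: (scalar_of_real (rnorm x)^-1 *: x) = x.
Proof.
move=> x0; rewrite scalar_of_realZA mulfV ?rnorm_eq0//.
by rewrite scalar_of_real1 scale1r.
Qed.

Lemma rnorm_normalize x : x != 0 ->
  rnorm (scalar_of_real (rnorm x)^-1 *: x) = 1.
Proof.
move=> x0; rewrite rnormZ_ge0 ?invr_ge0 ?rnorm_ge0// mulVf//.
by rewrite rnorm_eq0.
Qed.

End RealNorm.

(** * Modulus of smoothness and norming functionals *)

Section Space.
Context {R : realType} {k : field_kind}.
Local Notation K := (scalar_field R k).
Context {X : completeNormedModType K}.
Implicit Types (x y : X) (u : R).

(** The values whose supremum defines the modulus at [u] are bounded by [u], so
the supremum is a genuine one and not the default value of [sup]. *)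
Lemma smoothness_modulus_ub u x y : 0 <= u -> rnorm x = 1 -> rnorm y = 1 ->
  (rnorm (x + scalar_of_real u *: y) + rnorm (x - scalar_of_real u *: y)) / 2 - 1
  <= smoothness_modulus X u.
Proof.
move=> u0 x1 y1; apply: ub_le_sup; last by exists x, y.
exists u => _ [x' [y' [x'1 y'1 ->]]].
have := rnormD x' (scalar_of_real u *: y').
have := rnormB x' (scalar_of_real u *: y').
rewrite rnormZ_ge0// x'1 y'1; lra.
Qed.

(** Normalise both vectors and scale the definition of the modulus by
[rnorm x]. *)
Lemma smoothness_modulus_homog x y : x != 0 -> y != 0 ->
  rnorm (x + y) + rnorm (x - y) <=
  2 * rnorm x * (1 + smoothness_modulus X (rnorm y / rnorm x)).
Proof.
move=> x0 y0.
have nx := rnorm_gt0 x; rewrite x0 in nx.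
have ny := rnorm_gt0 y; rewrite y0 in ny.
set u := rnorm y / rnorm x.
have u0 : 0 <= u by rewrite divr_ge0// ltW.
have := @smoothness_modulus_ub u _ _ u0 (rnorm_normalize _ x0) (rnorm_normalize _ y0).
set x' := _ *: x; set y' := _ *: y.
have Ex : scalar_of_real (rnorm x) *: x' = x by exact: scale_normalize.
have Ey : scalar_of_real (rnorm x) *: (scalar_of_real u *: y') = y.
  by rewrite scalar_of_realZA /u mulrCA mulfV ?gt_eqF// mulr1 scale_normalize.
have ED : rnorm (x + y) = rnorm x * rnorm (x' + scalar_of_real u *: y').
  by rewrite -rnormZ_ge0 ?rnorm_ge0// scalerDr Ex Ey.
have EB : rnorm (x - y) = rnorm x * rnorm (x' - scalar_of_real u *: y').
  by rewrite -rnormZ_ge0 ?rnorm_ge0// scalerBr Ex Ey.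
rewrite ED EB -mulrDr -subr_ge0 => h.
rewrite (mulrC 2) -mulrA ler_pM2l//; lra.
Qed.

(** Take both test vectors equal to one unit vector [y]: then
[(y + u y) - (y - u y) = 2 u y], so the two norms add up to at least [2 u]. *)
Lemma smoothness_modulus_ge u x : 0 <= u -> x != 0 ->
  u - 1 <= smoothness_modulus X u.
Proof.
move=> u0 /rnorm_normalize; set y := _ *: x => y1.
apply: le_trans (@smoothness_modulus_ub u y y u0 y1 y1).
have := rnormB (y + scalar_of_real u *: y) (y - scalar_of_real u *: y).
have -> : y + scalar_of_real u *: y - (y - scalar_of_real u *: y) =
    scalar_of_real (u + u) *: y.
  by rewrite opprB addrC addrA subrK -scalerDl scalar_of_realD.
rewrite rnormZ_ge0 ?addr_ge0//. rewrite y1; lra.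
Qed.

(** Boundedness of [F] comes for free: [sup] is [0] on unbounded sets, so a
dual norm equal to [1] is a true supremum over the unit ball. *)
Lemma dual_norm1_bound (F : {linear X -> K^o}) x : dual_norm F = 1 ->
  rnorm (F x : K^o) <= rnorm x.
Proof.
move=> F1; have [->|x0] := eqVneq x 0; first by rewrite linear0 !rnorm0.
set S := [set rnorm (F z : K^o) | z in [set z : X | rnorm z <= 1]].
have [_ ubS] : has_sup S.
  by apply: contrapT => /sup_out; rewrite /S -/(dual_norm F) F1 => /eqP;
     rewrite oner_eq0.
rewrite -(scale_normalize x x0) linearZ.
move: (rnorm_normalize x x0); move: (_ *: x) => y y1 /=.
rewrite !rnormZ_ge0 ?rnorm_ge0// y1 ler_wpM2l ?rnorm_ge0// -F1.
by apply: ub_le_sup => //; exists y => //=; rewrite y1.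
Qed.

Lemma norming_functional_scale (h : X) (F : {linear X -> K^o}) (a : R) :
  0 <= a -> norming_functional h F ->
  norming_functional (scalar_of_real a *: h) F.
Proof.
move=> a0 [Fc F1 Fh]; split=> //.
by rewrite linearZ /= Fh normrZ scalar_of_real_norm ger0_norm.
Qed.

(** The one-step decrease estimate: [F] bounds [rnorm (x + y)] from below, and
the modulus of smoothness trades [rnorm (x + y)] for [rnorm (x - y)]. *)
Lemma rnorm_sub_le_smoothness (x y : X) (F : {linear X -> K^o}) :
  x != 0 -> y != 0 -> norming_functional x F ->
  rnorm (x - y) <= rnorm x - scalar_re (F y)
    + 2 * rnorm x * smoothness_modulus X (rnorm y / rnorm x).
Proof.
move=> x0 y0 [_ F1 Fx]; have := smoothness_modulus_homog x y x0 y0.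
have : rnorm x + scalar_re (F y) <= rnorm (x + y).
  apply: le_trans (dual_norm1_bound F (x + y) F1).
  apply: le_trans (scalar_re_le_norm _).
  by rewrite linearD scalar_reD Fx.
rewrite mulrDr mulr1; lra.
Qed.

Local Open Scope convex_scope.

(** The unit ball is convex, so it contains the convex hull; a point of norm
greater than [1] is at positive distance from it. *)
Lemma closed_conv_unit_ball (D : set X) (f : X) :
  (forall g, D g -> rnorm g <= 1) -> closed_conv D f -> rnorm f <= 1.
Proof.
move=> D1 fD; rewrite leNgt; apply/negP => f1.
have : nbhs f (ball f (scalar_of_real (rnorm f - 1))).
  apply: nbhsx_ballx; have -> : 0 = scalar_of_real 0 :> K by case: (k).
  by rewrite scalar_of_real_lt subr_gt0.
move=> /fD [g [gD]]; rewrite -ball_normE /= -rnormE scalar_of_real_lt => fg.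
have g1 : rnorm g <= 1.
  have : smallest (@convex_set K X) D `<=` [set g : X | rnorm g <= 1].
    apply: smallest_sub => // x y l; rewrite !inE /= => x1 y1.
    (* A convexity parameter is real even when the scalars are complex. *)
    have [l0 l1] : 0 <= l%:num :> K /\ l%:num <= 1 :> K by split.
    have El := scalar_re_ge0_inj _ l0.
    have re_l0 : 0 <= scalar_re (l%:num : K).
      by have := scalar_re_le _ _ l0; case: (k) (l%:num).
    have re_l1 : scalar_re (l%:num : K) <= 1.
      by have := scalar_re_le _ _ l1; case: (k) (l%:num).
    have -> : x <| l |> y = scalar_of_real (scalar_re (l%:num : K)) *: (x : X)
        + scalar_of_real (1 - scalar_re (l%:num : K)) *: (y : X).
      by rewrite scalar_of_realB scalar_of_real1 El.
    apply: le_trans (rnormD _ _) _.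
    rewrite !rnormZ_ge0 ?subr_ge0//.
    nra.
  exact.
have := rnormD (f - g) g; rewrite subrK; lra.
Qed.

(** The duality bound with the modulus replaced by its power-type majorant,
which, unlike the modulus, may be evaluated at an upper bound for the norm of
[y]. *)
Lemma rnorm_sub_le_power (gamma q t : R) (x y : X) (F : {linear X -> K^o}) :
  0 <= gamma -> 0 <= q ->
  (forall u : R, 0 < u -> smoothness_modulus X u <= gamma * u `^ q) ->
  x != 0 -> norming_functional x F -> rnorm y <= t ->
  rnorm (x - y) <= rnorm x - scalar_re (F y)
    + 2 * rnorm x * (gamma * (t / rnorm x) `^ q).
Proof.
move=> gamma0 q0 rho_le x0 Fx yt.
have nx := rnorm_gt0 x; rewrite x0 in nx.
have [->|y0] := eqVneq y 0.
  rewrite subr0 linear0; have -> : scalar_re (0 : K) = 0 by case: (k).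
  by rewrite subr0 lerDl !mulr_ge0 ?powR_ge0 ?rnorm_ge0.
have ny := rnorm_gt0 y; rewrite y0 in ny.
apply: le_trans (rnorm_sub_le_smoothness x y F x0 y0 Fx) _.
rewrite lerD2l ler_wpM2l ?mulr_ge0 ?rnorm_ge0//.
apply: le_trans (rho_le _ (divr_gt0 ny nx)) _.
rewrite ler_wpM2l// ge0_ler_powR ?nnegrE ?divr_ge0 ?rnorm_ge0//.
  exact: le_trans (rnorm_ge0 y) yt.
by rewrite ler_pM2r ?invr_gt0.
Qed.

(** Parallel vectors already force the modulus to be at least [u - 1]; at
[u = 2] this bounds [gamma] below by an absolute constant. *)
Lemma power_type_constant_ge (gamma q : R) (x : X) :
  0 < gamma -> 0 < q ->
  (forall u : R, 0 < u -> smoothness_modulus X u <= gamma * u `^ q) ->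
  x != 0 -> 1 <= 2 * gamma `^ q^-1.
Proof.
move=> gamma0 q0 rho_le x0.
have rho2 := le_trans (smoothness_modulus_ge 2 x (ler0n R 2) x0) (rho_le 2 (ltr0Sn R 1)).
rewrite leNgt; apply/negP => lt1.
have := @gt0_ltr_powR R q q0 (2 * gamma `^ q^-1) 1.
rewrite !nnegrE mulr_ge0 ?powR_ge0// => /(_ isT ler01 lt1).
rewrite powR1 powRM ?powR_ge0// -powRrM mulVf ?gt_eqF// powRr1 ?(ltW gamma0)//.
lra.
Qed.

End Space.

(** * The scalar recursion *)

Section Recursion.
Context {R : realType}.

(** Bernoulli's inequality for an exponent in [(0, 1)], here as Young's
inequality for [a^(1/t) * 1]. *)
Lemma powR_bernoulli (a t : R) : 0 <= a -> 1 < t ->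
  a `^ t^-1 <= 1 - t^-1 + a / t.
Proof.
move=> a0 t1; have t0 : 0 < t by lra.
have := @conjugate_powR R (a `^ t^-1) 1 t (1 - t^-1)^-1.
have t'0 : 0 < 1 - t^-1 by rewrite subr_gt0 invf_lt1.
move=> /(_ (powR_ge0 _ _) ler01 t0); rewrite invr_gt0 => /(_ t'0).
rewrite invrK subrKC => /(_ erefl).
by rewrite mulr1 -powRrM mulVf ?gt_eqF// powRr1// powR1 mul1r addrC.
Qed.

(** With [n = m + 1] and [m^(-(1-1/q)) = m^(1/q) / m], the claim reduces to
[(m / n)^(1/q) <= 1 - 1/(q n)], which is Bernoulli's inequality. *)
Lemma powR_succ_contract (q : R) (m : nat) : 1 < q -> (0 < m)%N ->
  (1 - m.+1%:R^-1) * m%:R `^ (- (1 - q^-1)) <=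
  m.+1%:R `^ (- (1 - q^-1)) * (1 - q^-1 / m.+1%:R) :> R.
Proof.
move=> q1 m0.
have [M0 N0] : 0 < m%:R :> R /\ 0 < m.+1%:R :> R by rewrite !ltr0n.
have -> : 1 - m.+1%:R^-1 = m%:R / m.+1%:R :> R.
  by rewrite -(addn1 m) natrD in N0 *; field; rewrite gt_eqF.
have E (x : R) : 0 < x -> x `^ (- (1 - q^-1)) = x^-1 * x `^ q^-1.
  move=> x0; rewrite opprB powRD ?(gt_eqF x0) ?implybT// mulrC.
  by rewrite powR_inv1// ltW.
rewrite !E// mulrA (mulrAC m%:R) mulfV ?gt_eqF// mul1r -mulrA ler_pM2l ?invr_gt0//.
have := @powR_bernoulli (m%:R / m.+1%:R) q (divr_ge0 (ltW M0) (ltW N0)) q1.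
rewrite powRM ?invr_ge0 ?(ltW M0) ?(ltW N0)//.
rewrite -ler_pdivrMl ?powR_gt0// mulrC -powRN -[- q^-1]mulN1r powRrM powR_inv1 ?(ltW N0)//.
move/le_trans; apply; rewrite -addn1 natrD in N0 *.
rewrite le_eqVlt; apply/orP; left; apply/eqP; field.
by rewrite !gt_eqF//; lra.
Qed.

(** The induction behind the rate: when the contracted value [A] is below the
target order the trivial increment is affordable, and when it is above, the
power-type error is of the same order as the greedy error and the contraction
gains more than both. The hypothesis on [b] turns the absolute increment
[2 / n] into a multiple of [b]. *)
Lemma incremental_recursion (q K b : R) (d : nat -> R) :
  1 < q <= 2 -> 0 < K -> 1 <= 2 * b -> (forall m, 0 <= d m) ->
  (forall m, d m.+1 <= (1 - m.+1%:R^-1) * d m + 2 / m.+1%:R) ->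
  (forall m, let A := (1 - m.+1%:R^-1) * d m in 0 < A ->
     d m.+1 <= A + K * b * m.+1%:R `^ (- (1 - q^-1)) / m.+1%:R
       + 2 * A * (b `^ q * (2 / m.+1%:R / A) `^ q)) ->
  forall m, (0 < m)%N -> d m <= (2 * K + 16) * b * m%:R `^ (- (1 - q^-1)).
Proof.
move=> /andP[q1 q2] K0 b1 d0 dtriv dsmooth; set s := 1 - q^-1.
have b0 : 0 < b by lra.
have q0 : 0 < q by lra.
have iq0 : 0 < q^-1 by rewrite invr_gt0.
have iq1 : q^-1 < 1 by rewrite invf_lt1.
have iq2 : 2^-1 <= q^-1 by rewrite lef_pV2 ?posrE.
elim=> // m IH _; set n := m.+1.
have n0 : 0 < n%:R :> R by rewrite ltr0n.
have n1 : 1 <= n%:R :> R by rewrite ler1n.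
set t := n%:R `^ (- s); have t0 : 0 < t by rewrite powR_gt0.
have nt : n%:R^-1 <= t.
  by rewrite -powR_inv1 ?(ltW n0)//; apply: ler_powR => //; rewrite /s; lra.
have in0 : 0 < n%:R^-1 :> R by rewrite invr_gt0.
set A := (1 - n%:R^-1) * d m.
have [Asmall|Abig] := leP A (b * t).
  apply: (le_trans (dtriv m)); rewrite -/n -/A.
  have : 2 / n%:R <= 2 * (2 * b) * t.
    apply: ler_pM => //; try exact: ltW; lra.
  have : 0 < K * b * t by rewrite !mulr_gt0.
  have : 0 < b * t by rewrite mulr_gt0.
  by rewrite !mulrDl; lra.
have A0 : 0 < A by apply: lt_trans Abig; rewrite mulr_gt0.
have m0 : (0 < m)%N.
  by move: A0; rewrite /A /n; case: (m) => //; rewrite invr1 subrr mul0r ltxx.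
have AC : A <= (2 * K + 16) * b * (t * (1 - q^-1 / n%:R)).
  apply: (@le_trans _ _ ((2 * K + 16) * b * ((1 - n%:R^-1) * m%:R `^ (- s)))).
    by rewrite [leRHS]mulrCA ler_wpM2l ?subr_ge0 ?invf_le1 ?IH.
  by rewrite ler_wpM2l ?powR_succ_contract// mulr_ge0 ?(ltW b0)//; lra.
have step := dsmooth m A0; rewrite -/n -/A -/s -/t in step; clearbody A.
(* The error term is [2 A (2 z)^q]; splitting [z^q = z^(q-1) z] cancels [A],
   and the lower bound on [A] makes [z^(q-1)] at most [n^(-s)]. *)
pose z := b / (n%:R * A).
have z0 : 0 < z by rewrite divr_gt0// mulr_gt0.
have zle : z <= n%:R `^ (- q^-1).
  have -> : - q^-1 = s - 1 by rewrite /s; lra.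
  rewrite powRD ?(gt_eqF n0) ?implybT// powR_inv1 ?(ltW n0)//.
  rewrite /z invfM mulrA mulrAC ler_pM2r// ler_pdivrMr//.
  have -> : n%:R `^ s = t^-1 by rewrite /t powRN invrK.
  by rewrite ler_pdivlMl// mulrC ltW.
have smooth : 2 * A * (b `^ q * (2 / n%:R / A) `^ q) <= 8 * (b * t / n%:R).
  have -> : b `^ q * (2 / n%:R / A) `^ q = 2 `^ q * z `^ q.
    rewrite -!powRM ?divr_ge0 ?mulr_ge0 ?invr_ge0 ?(ltW b0) ?(ltW n0) ?(ltW A0) ?(ltW z0)//.
    by congr (_ `^ _); rewrite /z; field; rewrite ?gt_eqF.
  have -> : z `^ q = z `^ (q - 1) * z.
    by rewrite -{3}[z]powRr1 ?(ltW z0)// -powRD ?(gt_eqF z0) ?implybT// subrK.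
  have -> : 2 * A * (2 `^ q * (z `^ (q - 1) * z)) =
            2 * (2 `^ q) * (z `^ (q - 1)) * (b / n%:R).
    by rewrite /z; field; rewrite !gt_eqF.
  have two_q : 2 `^ q <= 4 :> R.
    by have -> : 4 = 2 `^ 2%:R :> R; [rewrite powR_mulrn//; ring|apply: ler_powR; lra].
  have zt : z `^ (q - 1) <= t.
    have -> : t = (n%:R `^ (- q^-1)) `^ (q - 1).
      by rewrite -powRrM; congr (_ `^ _); rewrite /s; field; rewrite gt_eqF.
    by apply: ge0_ler_powR; rewrite ?nnegrE ?powR_ge0 ?(ltW z0)//; lra.
  have -> : 8 * (b * t / n%:R) = 2 * 4 * t * (b / n%:R) by ring.
  rewrite ler_wpM2r ?divr_ge0 ?(ltW b0)// ler_pM ?mulr_ge0 ?powR_ge0//.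
  by rewrite ler_pM2l.
apply: (le_trans step).
have : 0 < b * t / n%:R by rewrite divr_gt0// mulr_gt0.
set w := b * t / n%:R in smooth * => w0.
have -> : K * b * t / n%:R = K * w by rewrite /w; ring.
have AC' : A <= (2 * K + 16) * b * t - (2 * K + 16) * q^-1 * w.
  by apply: le_trans AC _; rewrite /w le_eqVlt; apply/orP; left; apply/eqP; ring.
have : (2 * K + 16) * 2^-1 * w <= (2 * K + 16) * q^-1 * w.
  by rewrite ler_wpM2r ?(ltW w0)// ler_wpM2l//; lra.
lra.
Qed.

End Recursion.

Theorem theorem3p6 (R : realType) (K1 : R) (hK1 : 0 < K1) :
  exists C : R,
  forall (k : field_kind) (X : completeNormedModType (scalar_field R k))
    (gamma q p : R) (D : set X) (eps : nat -> R),
  uniformly_smooth X ->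
  0 < gamma ->
  1 < q <= 2 ->
  p = q / (q - 1) ->
  (forall u : R, 0 < u -> smoothness_modulus X u <= gamma * u `^ q) ->
  dictionary D ->
  (forall n : nat, (0 < n)%N ->
     eps n = K1 * gamma `^ (q^-1) * n%:R `^ (- p^-1)) ->
  forall (f : X) (phi G r : nat -> X),
  closed_conv D f ->
  IAcc_run D eps f phi G r ->
  forall m : nat, (0 < m)%N ->
    rnorm (r m) <= C * gamma `^ (q^-1) * m%:R `^ (- p^-1).
Proof.
exists (2 * K1 + 16) => k X gamma q p D eps _ gamma0 q12 pE rho_le [D1 _] epsE.
move=> f phi G r fD [G0 r0 phiD greedy GE rE] m m0.
set b := gamma `^ q^-1; have b0 : 0 < b by rewrite powR_gt0.
have q0 : 0 < q by case/andP: q12 => q1 _; lra.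
have sE : p^-1 = 1 - q^-1.
  by rewrite pE invf_div mulrBl mulfV ?gt_eqF// mul1r.
(* A nonzero residual also shows that the space is nontrivial, without which
   [gamma] has no lower bound. *)
have [->|rm0] := eqVneq (r m) 0.
  by rewrite rnorm0 !mulr_ge0 ?powR_ge0 ?(ltW b0)//; lra.
have b1 : 1 <= 2 * b := power_type_constant_ge _ _ _ gamma0 q0 rho_le rm0.
have bq : b `^ q = gamma.
  by rewrite /b -powRrM mulVf ?gt_eqF// powRr1// ltW.
have f1 : rnorm f <= 1 by exact: closed_conv_unit_ball D1 fD.
have dist n : (0 < n)%N -> rnorm (phi n - f) <= 2.
  move=> n0; apply: le_trans (rnormB _ _) _.
  have := D1 _ (phiD n n0); lra.
have invn_ge0 (n : nat) : 0 <= n.+1%:R^-1 :> R by rewrite invr_ge0.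
have invn_le1 (n : nat) : 0 <= 1 - n.+1%:R^-1 :> R.
  by rewrite subr_ge0 invf_le1 ?ltr0n// ler1n.
have step n : r n.+1 = scalar_of_real (1 - n.+1%:R^-1) *: r n
                       - scalar_of_real n.+1%:R^-1 *: (phi n.+1 - f).
  have rG : r n = f - G n.
    by case: n => [|n]; [rewrite r0 G0 subr0 | exact: rE].
  rewrite rE// GE// rG scalar_of_realB scalar_of_real1 scalar_of_real_natV /=.
  set c := _^-1; have {1}-> : f = (1 - c) *: f + c *: f.
    by rewrite -scalerDl subrK scale1r.
  by rewrite !scalerBr opprB opprD addrACA.
rewrite sE; apply: (incremental_recursion q K1 b (fun n => rnorm (r n))) => //.
- by move=> n; exact: rnorm_ge0.
- move=> n; rewrite step; apply: le_trans (rnormB _ _) _.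
  rewrite !rnormZ_ge0// lerD2l mulrC ler_wpM2r//.
  exact: dist.
move=> n A A0.
have rn0 : r n != 0.
  by apply/eqP => rn0; move: A0; rewrite /A rn0 rnorm0 mulr0 ltxx.
have [F [Fr Fphi]] := greedy n.+1 isT rn0.
have AE : rnorm (scalar_of_real (1 - n.+1%:R^-1) *: r n) = A by rewrite rnormZ_ge0.
have := rnorm_sub_le_power gamma q (2 / n.+1%:R)
  (scalar_of_real (1 - n.+1%:R^-1) *: r n)
  (scalar_of_real n.+1%:R^-1 *: (phi n.+1 - f)) F (ltW gamma0) (ltW q0) rho_le.
rewrite -step AE -rnorm_gt0 AE => /(_ A0).
move=> /(_ (norming_functional_scale _ _ _ (invn_le1 n) Fr)).
rewrite rnormZ_ge0// mulrC ler_wpM2r ?dist// => /(_ isT) /le_trans; apply.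
rewrite bq lerD2r lerD2l linearZ scalar_reM -mulrN mulrC -sE.
by rewrite ler_wpM2r// -epsE// lerNl.
Qed.
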